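(* Let $P=\{1324\}$ and, for $n\ge1$ and $l\ge0$, let $c_{n,l}$ be the number of permutations of $\{1,\dots,n\}$ that are $(l+1)$-chains for $P$ (i.e. are obtained by linking $l$ occurrences of $1324$); set $c_{n,l}=0$ for $l<0$. Then $c_{1,l}=\delta_{0,l}$, $c_{2,l}=c_{3,l}=0$, and for all $n\ge4$ and $l\ge0$, $$c_{n,l}=\sum_{k\ge1,\ 2k+2\le n}\frac{1}{k+1}\binom{2k}{k}\,c_{n-2k-1,\,l-k}.$$ Consequently the exponential generating function of permutations avoiding $1324$ is $$g_{\{1324\}}(t)=\Big(1-t-\sum_{n\ge2,\,l\ge1}\frac{(-1)^l c_{n,l}}{n!}t^n\Big)^{-1}.$$
   Context: For a word $s=s_1\dots s_j$ of distinct integers, $\mathrm{st}(s)$ is the permutation $\rho$ of $\{1,\dots,j\}$ with $s_i<s_r\iff\rho_i<\rho_r$; an occurrence of a pattern $\pi$ of length $j$ in a word $w$ is a factor $w_i\dots w_{i+j-1}$ with $\mathrm{st}(w_i\dots w_{i+j-1})=\pi$; a permutation avoids $\pi$ if it has no occurrence. $g_P(t)=1+\sum_{n\ge1}\frac{a^P_n}{n!}t^n$ with $a^P_n$ the number of permutations of $\{1,\dots,n\}$ avoiding all patterns of $P$. Chains and tails: the empty word is a $0$-chain, its own tail; each one-letter word is a $1$-chain, its own tail; for $q\ge2$ a $q$-chain is a word $\sigma$ with a factorization $\sigma=\sigma'\tau$ where $\sigma'$ is a $(q-1)$-chain with tail $\tau'$ and $\tau'\tau$ contains exactly one occurrence of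 a pattern from $P$, this occurrence being a suffix of $\tau'\tau$; $\tau$ is the tail of $\sigma$. $\delta$ is the Kronecker delta.
   Formalization: In the definition of a q-chain the occurrence ending τ'τ is also required to start inside the previous tail τ'; without this, 51324 (τ'=5, τ=1324) would be a 2-chain, so c_{5,1}≥1, contradicting the recurrence, which gives c_{5,1}=c_{2,0}=0. *)

(* Defs.v *)
From mathcomp Require Import all_boot all_order all_algebra.
From mathcomp Require Import boolp zify.

Set Implicit Arguments.
Unset Strict Implicit.
Unset Printing Implicit Defensive.

Import Order.TTheory GRing.Theory Num.Theory.

Definition word := seq nat.

Definition st (s : word) : word := [seq (count (fun y => y < x) s).+1 | x <- s].

Lemma size_st s : size (st s) = size s.
Proof. by rewrite size_map. Qed.

Lemma ltn_nth_st s i r : i < size s -> r < size s ->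
  (nth 0 (st s) i < nth 0 (st s) r) = (nth 0 s i < nth 0 s r).
Proof.
move=> lti ltr; rewrite !(nth_map 0) // ltnS.
set x := nth 0 s i; set y := nth 0 s r.
case: (ltnP x y) => [xy | yx]; last first.
  apply/negbTE; rewrite -leqNgt; apply: sub_count => z /= zy; exact: leq_trans yx.
have -> : count (fun z => z < y) s
        = count (fun z => z < x) s + count (fun z => x <= z < y) s.
  rewrite -count_predUI [X in _ = _ + X](eq_count (a2 := pred0)) ?count_pred0 ?addn0.
    by apply: eq_count => z /=; lia.
  by move=> z /=; lia.
rewrite -[X in X < _]addn0 ltn_add2l -has_count; apply/hasP; exists x => /=.
  exact: mem_nth.
by rewrite leqnn xy.
Qed.

Lemma perm_st s : uniq s -> perm_eq (st s) (iota 1 (size s)).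
Proof.
move=> us; have ust : uniq (st s).
  apply/(uniqP 0) => i r; rewrite !inE !size_st => lti ltr e.
  apply/eqP; rewrite -(nth_uniq 0 lti ltr us).
  have h1 := ltn_nth_st lti ltr; have h2 := ltn_nth_st ltr lti.
  by move: h1 h2; rewrite e !ltnn; case: ltngtP.
have sub : {subset st s <= iota 1 (size s)}.
  move=> _ /mapP[x xs ->]; rewrite mem_iota add1n ltnS /= -(count_predC (fun y => y < x) s).
  rewrite -[X in X < _]addn0 ltn_add2l -has_count; apply/hasP; exists x => //=.
  by rewrite ltnn.
apply: uniq_perm => //; first exact: iota_uniq.
by case: (uniq_min_size ust sub); rewrite ?size_iota ?size_st.
Qed.

Lemma st_unique s rho : perm_eq rho (iota 1 (size s)) ->
  (forall i r, i < size s -> r < size s ->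
     (nth 0 s i < nth 0 s r) = (nth 0 rho i < nth 0 rho r)) ->
  rho = st s.
Proof.
move=> prho iso; have srho : size rho = size s by rewrite (perm_size prho) size_iota.
apply: (@eq_from_nth _ 0) => [|i]; rewrite srho ?size_st // => lti.
have : nth 0 rho i \in rho by rewrite mem_nth ?srho.
rewrite (perm_mem prho) mem_iota => hi; rewrite (nth_map 0) //.
have -> : count (fun y => y < nth 0 s i) s = count (fun y => y < nth 0 rho i) rho.
  rewrite -{2}(mkseq_nth 0 s) -{2}(mkseq_nth 0 rho) !count_map srho.
  by apply: eq_in_count => r; rewrite mem_iota /= => ltr; rewrite iso.
have /permP -> := prho; set x := nth 0 rho i in hi *.
have -> : size s = x.-1 + (size s - x.-1) by lia.
rewrite iotaD count_cat (eq_in_count (a2 := predT)); last first.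
  by move=> y; rewrite mem_iota /=; lia.
rewrite count_predT size_iota (eq_in_count (a2 := pred0)) ?count_pred0; first by lia.
by move=> y; rewrite mem_iota /=; lia.
Qed.

Definition factor (w : word) (i j : nat) : word := take j (drop i w).

(* (i, j) stands for the occurrence in w made of the j letters from position i
   (counted from 0) on. *)
Definition occurrences (P : pred word) (w : word) : seq (nat * nat) :=
  [seq p <- [seq (i, j) | i <- iota 0 (size w), j <- iota 1 (size w - i)]
  | P (st (factor w p.1 p.2))].

Definition avoids (P : pred word) (w : word) : bool := nilp (occurrences P w).

(* The occurrence links t' to t: it has to start inside t' (equivalently, the
   new tail t avoids P).  This part of the usual definition of chains is often
   left implicit; without it 51324 would be a 2-chain for 1324, with tail 1324,
   although its first letter belongs to no occurrence. *)
Definition linked (P : pred word) (t' t : word) : Prop :=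
  exists i j, [/\ occurrences P (t' ++ t) = [:: (i, j)],
                  i + j = size (t' ++ t) & i < size t'].

(* chain P q s t : s is a q-chain for P with tail t. *)
Inductive chain (P : pred word) : nat -> word -> word -> Prop :=
| chain0 : chain P 0 [::] [::]
| chain1 x : chain P 1 [:: x] [:: x]
| chainS q s' t' t :
    1 <= q -> chain P q s' t' -> linked P t' t -> chain P q.+1 (s' ++ t) t.

Definition is_chain (P : pred word) (q : nat) (s : word) : Prop :=
  exists t, chain P q s t.

Definition perms (n : nat) : seq word := permutations (iota 1 n).

Definition num_avoiding (P : pred word) (n : nat) : nat :=
  count (avoids P) (perms n).

Definition num_chains (P : pred word) (q n : nat) : nat :=
  count (fun w => `[< is_chain P q w >]) (perms n).

Definition P1324 : pred word := pred1 [:: 1; 3; 2; 4].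

Definition c (n : nat) (l : int) : nat :=
  match l with
  | Posz l => num_chains P1324 l.+1 n
  | Negz _ => 0
  end.

Lemma linked_tail_avoids P t' t : linked P t' t -> avoids P t.
Proof.
case=> i [j [E _ lti]]; rewrite /avoids /nilp size_eq0.
apply/negP => /negP /eqP/eqP; rewrite -has_filter => /hasP[[a b] /allpairsPdep[a' [b' [ha hb]]]].
case=> -> -> /= Pab.
suff : (size t' + a', b') \in occurrences P (t' ++ t).
  by rewrite E inE xpair_eqE => /andP[/eqP] ; lia.
move: ha hb; rewrite !mem_iota => ha hb.
rewrite /occurrences mem_filter /= /factor drop_cat.
have -> : (size t' + a' < size t') = false by lia.
rewrite addKn Pab /=; apply/allpairsPdep; exists (size t' + a'), b'.
by rewrite !mem_iota size_cat; split => //; lia.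
Qed.

Lemma chain_size P q s t :
  ~~ P [:: 1] -> chain P q s t -> q <= size s /\ avoids P t.
Proof.
move=> nP1; elim=> [||{}q s' t' {}t q0 _ [IH avt'] L] //.
- by move=> x; split=> //; rewrite /avoids /occurrences /= /st /= ltnn (negbTE nP1).
- split; last exact: linked_tail_avoids L.
  rewrite size_cat; case: t L => [|x t] L; last by rewrite /=; lia.
  by case: L avt' => i [j [E _ _]]; rewrite cats0 in E; rewrite /avoids E.
Qed.

Lemma c_eq0 n (l : nat) : n <= l -> c n l = 0.
Proof.
move=> nl; apply/eqP; rewrite -leqn0 leqNgt -has_count; apply/hasPn => w.
rewrite /perms mem_permutations => /perm_size; rewrite size_iota => sw.
by apply/asboolP => -[t /chain_size[] //]; rewrite sw; lia.
Qed.

Local Open Scope ring_scope.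

(* Formal power series over rat, as sequences of coefficients. *)
Definition fps := nat -> rat.

Definition fps1 : fps := fun n => (n == 0%N)%:R.

Definition fps_mul (a b : fps) : fps :=
  fun n => \sum_(i < n.+1) a i * b (n - i)%N.

Definition egf_avoiding (P : pred word) : fps :=
  fun n => if (n == 0)%N then 1 else (num_avoiding P n)%:R / n`!%:R.

(* 1 - t - \sum_(n >= 2, l >= 1) (-1)^l c_{n,l} / n! t^n.  By c_eq0 the terms
   with l >= n vanish, so that the inner sum over l is finite. *)
Definition denom1324 : fps :=
  fun n => (n == 0%N)%:R - (n == 1%N)%:R
    - (if (2 <= n)%N then \sum_(1 <= l < n) (-1) ^+ l * (c n l)%:R / n`!%:R else 0).

(* Main.v *)
(* The pattern 1324 overlaps itself only in shifts 2 and 3, never in shift 1;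
   hence a chain is a word covered by occurrences that start 2 or 3 letters
   apart, and all its occurrences are links of the chain.

   Recurrence: let k be the number of occurrences in the initial run of
   shift-2 links.  The remaining chain starts at position 2k+1 with its least
   letter, which is larger than the first 2k+1 letters; so these are
   1, ..., 2k+1, and after the leading 1 they form a standard Young tableau of
   shape (k, k), whence the Catalan number.

   Generating function: for every nonempty word w, the sum of (-1)^q over the
   factorizations w = uv with u a q-chain and v avoiding 1324 vanishes.  Summing
   over all permutations gives the product formula, since the relative orders
   of the two blocks of a random permutation are independent and uniform. *)
Require Import Defs.
From mathcomp Require Import all_boot all_order all_algebra.
From mathcomp Require Import boolp zify lra.

Set Implicit Arguments.
Unset Strict Implicit.
Unset Printing Implicit Defensive.

Import Order.TTheory GRing.Theory Num.Theory.

(** * Occurrences of 1324 as inequalities between letters *)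

Definition occ (w : word) (i : nat) : bool :=
  [&& i + 4 <= size w, nth 0 w i < nth 0 w i.+2,
      nth 0 w i.+2 < nth 0 w i.+1 & nth 0 w i.+1 < nth 0 w i.+3].

Lemma occ_size w i : occ w i -> i + 4 <= size w.
Proof. by case/andP. Qed.

Lemma occ_drop w d i : occ (drop d w) i = occ w (d + i).
Proof.
rewrite /occ size_drop !nth_drop !addnS.
by congr [&& _, _, _ & _]; lia.
Qed.

Lemma occ_take w m i : occ (take m w) i = (i + 4 <= m) && occ w i.
Proof.
rewrite /occ size_take_min leq_min; case: (leqP (i + 4) m) => //= h.
by rewrite !nth_take //; lia.
Qed.

(** Shift 1 is impossible: an occurrence at [i] makes the letter at [i.+2] smaller than the one at
    [i.+1], while an occurrence at [i.+1] makes it larger. *)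
Lemma occN_next w i : occ w i -> occ w i.+1 = false.
Proof. by rewrite /occ => /and4P[_ _ h _]; apply/negP => /and4P[_]; lia. Qed.

Lemma occ_cat_suffix u v i : occ (u ++ v) (size u + i) = occ v i.
Proof. by rewrite -[in RHS](drop_size_cat v (erefl (size u))) occ_drop. Qed.

Lemma P1324_factor w i j : i + j <= size w ->
  P1324 (st (factor w i j)) = (j == 4) && occ w i.
Proof.
move=> lew; rewrite /P1324 /=.
have sf : size (factor w i j) = j by rewrite /factor size_take_min size_drop; lia.
have nthf r : r < j -> nth 0 (factor w i j) r = nth 0 w (i + r).
  by move=> rj; rewrite /factor nth_take // nth_drop.
case: (j =P 4) => [ej|j4]; last first.
  by apply/negP => /eqP/(congr1 size); rewrite size_st sf.
rewrite /occ; subst j; rewrite lew /=.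
have f0 := nthf 0 isT; have f1 := nthf 1 isT; have f2 := nthf 2 isT; have f3 := nthf 3 isT.
rewrite addn0 addn1 addn2 addn3 in f0 f1 f2 f3.
apply/eqP/idP => [e | /and3P[h1 h2 h3]].
  have lt x y := @ltn_nth_st (factor w i 4) x y.
  rewrite sf e in lt.
  by rewrite -f0 -f1 -f2 -f3 -!lt.
apply/esym/st_unique; rewrite sf //.
by do 4?[case=> [|]]=> //; do 4?[case=> [|]]=> //= _ _; rewrite ?f0 ?f1 ?f2 ?f3; lia.
Qed.

Lemma mem_occurrences w p : (p \in occurrences P1324 w) = (p.2 == 4) && occ w p.1.
Proof.
case: p => i j; rewrite mem_filter /=.
apply/andP/andP => [[Pw /allpairsPdep[a [b [ha hb [ei ej]]]]] | [/eqP-> oi]].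
  subst a b; move: ha hb; rewrite !mem_iota => ha hb.
  by move: Pw; rewrite P1324_factor; [move/andP | lia].
have lei := occ_size oi.
rewrite P1324_factor // oi; split=> //; apply/allpairsPdep; exists i, 4.
by rewrite !mem_iota; split=> //; lia.
Qed.

Lemma uniq_occurrences w : uniq (occurrences P1324 w).
Proof.
apply/filter_uniq/allpairs_uniq_dep; first exact: iota_uniq.
  by move=> i _; exact: iota_uniq.
by move=> [? ?] [? ?] _ _ /= [-> ->].
Qed.

Lemma avoidsP w : reflect (forall i, occ w i = false) (avoids P1324 w).
Proof.
rewrite /avoids; apply: (iffP nilP) => [e i | h].
  by have := mem_occurrences w (i, 4); rewrite e.
case e : (occurrences P1324 w) => [//|p s].
by have := mem_occurrences w p; rewrite e mem_head h andbF.
Qed.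

Lemma avoids_drop1 w : avoids P1324 w = ~~ occ w 0 && avoids P1324 (drop 1 w).
Proof.
apply/avoidsP/andP => [h | [h0 /avoidsP h] [|i]].
- by rewrite h; split=> //; apply/avoidsP => i; rewrite occ_drop.
- exact: negbTE.
- by rewrite -add1n -occ_drop.
Qed.

Lemma linkedP t' t : linked P1324 t' t <->
  exists i, [/\ forall j, occ (t' ++ t) j = (j == i), i + 4 = size (t' ++ t) & i < size t'].
Proof.
split=> [[i [j [e sz lt]]] | [i [h sz lt]]].
  have := mem_occurrences (t' ++ t) (i, j).
  rewrite e mem_head => /esym/andP[/eqP /= ej _]; subst j.
  exists i; split=> // j.
  by have := mem_occurrences (t' ++ t) (j, 4); rewrite e inE xpair_eqE /= andbT => ->.
exists i, 4; split=> //; apply/perm_small_eq => //; apply: uniq_perm => //.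
  exact: uniq_occurrences.
by move=> [a b]; rewrite mem_occurrences inE xpair_eqE h andbC.
Qed.

(** * Chains as a boolean recursion *)

(* The pattern 1324 overlaps itself only in shifts 2 and 3, so a chain of
   length at least 2 is an occurrence at its start followed, two or three
   letters later, by a chain with one link less. *)
Fixpoint chainb (q : nat) (w : word) : bool :=
  match q with
  | 0 => nilp w
  | 1 => size w == 1
  | (_.+1 as q').+1 => occ w 0 && (chainb q' (drop 2 w) || chainb q' (drop 3 w))
  end.

Lemma chainbSS q w :
  chainb q.+2 w = occ w 0 && (chainb q.+1 (drop 2 w) || chainb q.+1 (drop 3 w)).
Proof. by []. Qed.

Lemma chainb1 w : chainb 1 w = (size w == 1).
Proof. by []. Qed.

Arguments chainb : simpl never.

Lemma chainb_occ0 q w : chainb q.+2 w -> occ w 0.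
Proof. by case/andP. Qed.

Lemma chainb_size q w : chainb q.+1 w -> 0 < size w.
Proof. by case: q => [/eqP-> // | q /chainb_occ0/occ_size]; lia. Qed.

(** Starts at 2 and at 3 would be in shift 1; for one-letter remainders the lengths disagree. This
    exclusion lets the disjunction in [chainbSS] be counted as a sum. *)
Lemma chainb_excl q w : chainb q.+1 (drop 2 w) -> chainb q.+1 (drop 3 w) = false.
Proof.
case: q => [|q /chainb_occ0 h]; first by rewrite !chainb1 !size_drop; lia.
rewrite occ_drop addn0 in h.
by apply/negP => /chainb_occ0; rewrite occ_drop (occN_next h).
Qed.

Lemma chainb2 w : chainb 2 w = (size w == 4) && occ w 0.
Proof.
rewrite chainbSS !chainb1 !size_drop andbC; case o: (occ w 0); rewrite ?andbF // !andbT.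
by have := occ_size o; lia.
Qed.

(** Links are added on the right in [chain] but removed on the left in [chainb]; this recursion from
    the right reconciles the two. *)
Lemma chainb_right q w : chainb q.+2 w = occ w (size w - 4) &&
  (chainb q.+1 (take (size w - 2) w) || chainb q.+1 (take (size w - 3) w)).
Proof.
elim: q w => [|q IH] w.
  rewrite chainb2 !chainb1 !size_take_min.
  case: (leqP 4 (size w)) => h; last first.
    have -> : occ w (size w - 4) = false by apply/negP => /occ_size; lia.
    by lia.
  case: eqP => [-> /=|n4]; first by rewrite andbT.
  by apply/esym/negbTE; rewrite negb_and; apply/orP; right; lia.
case: q IH => [_ | q IH].
  rewrite chainbSS !chainb2 !size_drop !size_take_min !occ_drop !occ_take /=.
  case: (size w =P 6) => [->|n6]; first by rewrite /= !orbF andbC.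
  case: (size w =P 7) => [->|n7]; first by rewrite /= andbC.
  have -> : size w - 2 == 4 = false by lia.
  have -> : size w - 3 == 4 = false by lia.
  have -> : minn (size w - 2) (size w) == 4 = false by lia.
  have -> : minn (size w - 3) (size w) == 4 = false by lia.
  by rewrite !andbF.
have X0 v : size v < 4 -> chainb q.+2 v = false.
  by move=> hv; apply/negP => /chainb_occ0/occ_size; lia.
rewrite [LHS]chainbSS [chainb _ (take (_ - 2) _)]chainbSS [chainb _ (take (_ - 3) _)]chainbSS.
rewrite !IH !size_drop !occ_drop.
case: (ltnP (size w) 8) => hw.
  by rewrite !X0 ?andbF // ?(size_take_min, size_drop); lia.
rewrite !take_drop !occ_take.
have -> : 2 + (size w - 2 - 4) = size w - 4 by lia.
have -> : 3 + (size w - 3 - 4) = size w - 4 by lia.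
have -> : size w - 2 - 2 + 2 = size w - 2 by lia.
have -> : size w - 2 - 3 + 2 = size w - 3 by lia.
have -> : size w - 3 - 2 + 3 = size w - 2 by lia.
have -> : size w - 3 - 3 + 3 = size w - 3 by lia.
have -> : 0 + 4 <= size w - 2 by lia.
have -> : 0 + 4 <= size w - 3 by lia.
(* Both sides consist of the two extreme occurrences and the four words left after cutting 2 or 3
   letters at each end, listed in different orders. *)
case: (occ w 0); case: (occ w (size w - 4)); rewrite ?andbF //=.
by rewrite -!orbA; congr (_ || _); rewrite orbCA.
Qed.

(** The next link is tested against the tail only, so the induction has to carry the tail as well:
    from the first link on it consists of the last two or three letters. *)
Lemma chain_tail q s t : chain P1324 q s t ->
  [/\ chainb q s, q <= 1 -> t = s
    & 1 < q -> exists2 d, 1 < d < 4 & t = drop (size s - d) s].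
Proof.
elim=> [||{}q s' t' {}t q0 _ [cs' t'1 t'2] /linkedP[i [oi sz lti]]].
- by split.
- by move=> x; split.
case: q q0 cs' t'1 t'2 => [//|[|q]] _ cs' t'1 t'2.
  have et := t'1 isT; subst t'; have s1 : size s' = 1 by apply/eqP.
  have i0 : i = 0 by lia.
  subst i; rewrite size_cat in sz.
  split=> //.
    by rewrite chainb2 oi size_cat andbT; lia.
  move=> _; exists 3 => //; rewrite size_cat drop_cat; case: ltnP => h; first lia.
  by rewrite (_ : _ - _ = 0) ?drop0 //; lia.
have [d hd et] := t'2 isT.
have o' := cs'; rewrite chainb_right in o'; case/andP: o' => o' _.
have so' := occ_size o'.
have szt' : size t' = d by rewrite et size_drop; lia.
have es : s' = take (size s' - d) s' ++ t' by rewrite et cat_take_drop.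
set u := take _ _ in es; have su : size u = size s' - d by rewrite size_take_min; lia.
rewrite size_cat in sz.
have on : occ (s' ++ t) (size u + i) by rewrite es -catA occ_cat_suffix oi.
have os : occ (s' ++ t) (size s' - 4).
  by rewrite -[s' in occ s'](take_size_cat t (erefl (size s'))) occ_take in o'; case/andP: o'.
(* The new occurrence starts [size t] letters after the last one of [s']. Since it starts among the
   at most three letters of [t'], the shift is 1, 2 or 3, and shift 1 is impossible. *)
have ht : 1 < size t < 4.
  case: (size t =P 0) => [t0|].
    have := oi (size s' - 4 - size u).
    have : size u + i = size s' - 4 by lia.
    by lia.
  have : size t = 1 -> False.
    move=> t1; have := occN_next os; rewrite (_ : _.+1 = size u + i) ?on //; lia.
  by lia.
split=> //.
  rewrite chainb_right size_cat (_ : _ - 4 = size u + i) ?on; last lia.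
  have [e|e] : size t = 2 \/ size t = 3 by lia.
    by rewrite e addnK take_size_cat // cs'.
  by rewrite e addnK [in X in _ || X]take_size_cat // cs' orbT.
by exists (size t) => //; rewrite size_cat addnK drop_size_cat.
Qed.

Lemma is_chainP q w : reflect (is_chain P1324 q w) (chainb q w).
Proof.
apply: (iffP idP) => [|[t /chain_tail[]] //].
elim: q w => [|q IH] w.
  by move=> /nilP->; exists [::]; constructor.
case: q IH => [|q] IH.
  by case: w => [|x [|]] // _; exists [:: x]; constructor.
rewrite chainb_right => /andP[on hw].
have sw : 4 <= size w by have := occ_size on; lia.
have [d hd cd] : exists2 d, 1 < d < 4 & chainb q.+1 (take (size w - d) w).
  by case/orP: hw; [exists 2 | exists 3].
have [t' ct'] := IH _ cd.
exists (drop (size w - d) w); rewrite -{1}(cat_take_drop (size w - d) w).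
apply: chainS (ct') _ => //; apply/linkedP.
have [_ t'1 t'2] := chain_tail ct'.
set s' := take _ _ in cd ct' t'1 t'2.
have ss' : size s' = size w - d by rewrite size_take_min; lia.
case: q IH hw cd ct' t'1 t'2 => [|q] _ _ cd ct' t'1 t'2.
  rewrite (t'1 isT) cat_take_drop; move: cd => /eqP s1.
  have w4 : size w = 4 by lia.
  exists 0; rewrite s1; split=> // j; case: j => [|j]; first by rewrite w4 in on.
  by apply/negP => /occ_size; lia.
have [d' hd' et'] := t'2 isT.
rewrite chainb_right in cd; case/andP: cd => os _.
have lts := occ_size os.
have szt' : size t' = d' by rewrite et' size_drop; lia.
have -> : t' ++ drop (size w - d) w = drop (size s' - d') w.
  by rewrite -[w in RHS](cat_take_drop (size w - d)) drop_cat -/s' et'; case: ltnP => //; lia.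
rewrite occ_take in os; case/andP: os => _ os.
exists (size w - 4 - (size s' - d')); rewrite size_drop; split; try lia.
(* Any other occurrence in [t' ++ t] would be in shift 1 with the last occurrence of [s'] or with
   the final one. *)
move=> j; rewrite occ_drop; case: eqP => [->|nj].
  by rewrite subnKC //; lia.
apply/negP => oj; have lj := occ_size oj.
have h1 : size w - 4 != (size s' - d' + j).+1.
  by apply/eqP => e; rewrite e (occN_next oj) in on.
have h2 : size s' - d' + j != (size s' - 4).+1.
  by apply/eqP => e; rewrite e (occN_next os) in oj.
by lia.
Qed.

Lemma num_chainsE q n : num_chains P1324 q n = count (chainb q) (perms n).
Proof. by apply: eq_count => w; apply/asboolP/is_chainP. Qed.

(** * Order invariance and independence of blocks *)

Definition order_invariant (T : Type) (f : word -> T) := forall (h : nat -> nat) (w : word),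
  {in w &, {mono h : x y / x < y}} -> f (map h w) = f w.

Lemma occ_invariant i : order_invariant (fun w => occ w i).
Proof.
move=> h w mh; rewrite /occ size_map; case: (leqP (i + 4) (size w)) => //= le4.
have lt r : r < 4 -> i + r < size w by lia.
have := (lt 0 isT, lt 1 isT, lt 2 isT, lt 3 isT).
rewrite addn0 addn1 addn2 addn3 => -[[[l0 l1] l2] l3].
by rewrite !(nth_map 0) ?mh ?mem_nth.
Qed.

Lemma avoids_invariant : order_invariant (avoids P1324).
Proof.
by move=> h w mh; apply/avoidsP/avoidsP => H i; have := occ_invariant i mh; rewrite H.
Qed.

Lemma chainb_invariant q : order_invariant (chainb q).
Proof.
elim: q => [|[|q] IH] h w mh; rewrite ?chainbSS.
- by rewrite /chainb /nilp size_map.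
- by rewrite !chainb1 size_map.
have md d : {in drop d w &, {mono h : x y / x < y}}.
  by move=> x y /mem_drop hx /mem_drop hy; apply: mh.
by rewrite (occ_invariant 0 mh) -!map_drop !IH.
Qed.

Lemma perm_permutations (T : eqType) (s t : seq T) :
  perm_eq s t -> perm_eq (permutations s) (permutations t).
Proof.
move=> st; apply: uniq_perm; rewrite ?permutations_uniq // => u.
by rewrite !mem_permutations (permPr st).
Qed.

Lemma permutations_map (h : nat -> nat) (s : word) : uniq s -> {in s &, injective h} ->
  perm_eq (permutations (map h s)) (map (map h) (permutations s)).
Proof.
move=> us ih; apply: uniq_perm; rewrite ?permutations_uniq //.
  rewrite map_inj_in_uniq ?permutations_uniq // => u v.
  rewrite !mem_permutations => pu pv.
  by apply: (inj_in_map ih); apply/allP => x; rewrite ?(perm_mem pu) ?(perm_mem pv).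
move=> u; rewrite mem_permutations; apply/idP/mapP => [pu|[v]].
  case/(perm_iotaP 0): pu => Is pIs ->; rewrite size_map in pIs.
  exists (map (nth 0 s) Is); first by rewrite mem_permutations; apply/(perm_iotaP 0); exists Is.
  rewrite -map_comp; apply/eq_in_map => i; rewrite (perm_mem pIs) mem_iota => /andP[_ hi].
  by rewrite /= (nth_map 0).
by rewrite mem_permutations => pv ->; apply: perm_map.
Qed.

(** The map sending [i] to the [i]-th smallest letter of [s] matches the two sets of permutations,
    and [p] does not see this relabelling. Letters count from 1 and positions from 0, whence
    [i.-1]. *)
Lemma count_permutations_st (p : pred word) (s : word) : order_invariant p -> uniq s ->
  count p (permutations s) = count p (perms (size s)).
Proof.
move=> ip us.
have ss : sorted ltn (sort leq s).
  by rewrite ltn_sorted_uniq_leq sort_uniq us sort_sorted //; apply: leq_total.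
have ps : perm_eq (sort leq s) (map (fun i => nth 0 (sort leq s) i.-1) (iota 1 (size s))).
  rewrite (iotaDl 1 0) -map_comp -[X in perm_eq X _](mkseq_nth 0) size_sort.
  exact: perm_refl.
have {}ps : perm_eq s (map (fun i => nth 0 (sort leq s) i.-1) (iota 1 (size s))).
  by rewrite -(permPl (permEl (perm_sort leq s))).
have mono : {in iota 1 (size s) &, {mono (fun i => nth 0 (sort leq s) i.-1) : x y / x < y}}.
  move=> x y; rewrite !mem_iota => hx hy.
  have lt := sorted_ltn_nth ltn_trans 0 ss; rewrite size_sort in lt.
  case: (ltngtP x y) => xy; last by rewrite xy ltnn.
    by apply: lt; rewrite ?inE; lia.
  suff : nth 0 (sort leq s) y.-1 < nth 0 (sort leq s) x.-1 by lia.
  by apply: lt; rewrite ?inE; lia.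
have inj : {in iota 1 (size s) &, injective (fun i => nth 0 (sort leq s) i.-1)}.
  by move=> x y hx hy e; have := mono _ _ hx hy; have := mono _ _ hy hx; rewrite e ltnn; lia.
have /permP -> := perm_permutations ps.
have /permP -> := permutations_map (iota_uniq 1 (size s)) inj.
rewrite count_map; apply: eq_in_count => u; rewrite mem_permutations => pu /=.
by apply: ip => x y; rewrite !(perm_mem pu); apply: mono.
Qed.

(** Rearrangements of the two blocks form a product, which gives their number and lets sums over
    them factor. *)
Lemma same_blocks_perm n m w : w \in perms n ->
  perm_eq [seq w' <- perms n | perm_eq (take m w') (take m w) && perm_eq (drop m w') (drop m w)]
          [seq u ++ v | u <- permutations (take m w), v <- permutations (drop m w)].
Proof.
rewrite mem_permutations => pw; have sw : size w = n by rewrite (perm_size pw) size_iota.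
apply: uniq_perm.
- exact/filter_uniq/permutations_uniq.
- apply: allpairs_uniq; rewrite ?permutations_uniq // => -[u v] [u' v'].
  move=> /allpairsP[[a b] [/= ha hb [-> ->]]] /allpairsP[[a' b'] [/= ha' hb' [-> ->]]].
  rewrite !mem_permutations in ha ha'.
  by move/eqP; rewrite eqseq_cat ?(perm_size ha) ?(perm_size ha') // => /andP[/eqP-> /eqP->].
move=> x; rewrite mem_filter mem_permutations; apply/idP/allpairsP => [/andP[/andP[h1 h2] _]|].
  by exists (take m x, drop m x); rewrite !mem_permutations cat_take_drop.
case=> -[u v] /= []; rewrite !mem_permutations => pu pv ->.
have pc : perm_eq (u ++ v) w by rewrite -(cat_take_drop m w) perm_cat.
rewrite (perm_trans pc pw) andbT.
case: (leqP m n) => mn.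
  have su : size u = m by rewrite (perm_size pu) size_take_min; lia.
  by rewrite take_size_cat // drop_size_cat // pu.
have v0 : v = [::] by apply/nilP; rewrite /nilp (perm_size pv) size_drop; lia.
move: pu pv; rewrite v0 cats0 => pu pv.
have su : size u <= m by rewrite (perm_size pu) size_take_min; lia.
by rewrite take_oversize // drop_oversize // pu pv.
Qed.

Lemma size_perms n w : w \in perms n -> size w = n.
Proof. by rewrite mem_permutations => /perm_size->; rewrite size_iota. Qed.

(* Averaging over the rearrangements of the two blocks makes them independent. *)
Lemma sum_blocks (R : pzRingType) (f g : word -> R) n m : m <= n ->
  ((m`! * (n - m)`!)%:R * (\sum_(w <- perms n) f (take m w) * g (drop m w)) =
   \sum_(w <- perms n) (\sum_(u <- permutations (take m w)) f u) *
      (\sum_(v <- permutations (drop m w)) g v))%R.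
Proof.
move=> mn.
pose S (w w' : word) := perm_eq (take m w') (take m w) && perm_eq (drop m w') (drop m w).
(* Each [w'] is counted once for every [w] with the same two blocks up to order, hence [m! (n - m)!]
   times. *)
transitivity (\sum_(w <- perms n) \sum_(w' <- perms n | S w w') f (take m w') * g (drop m w'))%R.
  rewrite (exchange_big_dep xpredT) //= mulr_sumr; apply: eq_big_seq => w pw.
  rewrite -big_filter big_const_seq.
  have -> : [seq i <- perms n | S i w] = [seq i <- perms n | S w i].
    by apply: eq_filter => i; rewrite /S perm_sym [in X in _ && X]perm_sym.
  have szw : size w = n by move: pw; rewrite mem_permutations => /perm_size->; rewrite size_iota.
  have uw : uniq w by move: pw; rewrite mem_permutations => /perm_uniq->; rewrite iota_uniq.
  rewrite count_predT (perm_size (same_blocks_perm m pw)) size_allpairs.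
  rewrite !size_permutations ?take_uniq ?drop_uniq // size_take_min size_drop szw (minn_idPl mn).
  by rewrite iter_addr_0 mulr_natl.
apply: eq_big_seq => w pw.
rewrite -big_filter (perm_big _ (same_blocks_perm m pw)) big_allpairs_dep /= mulr_suml.
apply: eq_big_seq => u; rewrite mem_permutations => pu.
rewrite mulr_sumr; apply: eq_bigr => v _.
have szw : size w = n by move: pw; rewrite mem_permutations => /perm_size->; rewrite size_iota.
have su : size u = m by rewrite (perm_size pu) size_take_min; lia.
by rewrite take_size_cat // drop_size_cat.
Qed.

(** * Initial runs of shift-2 links *)

Definition run (k : nat) (w : word) : bool := all (fun i => occ w i.*2) (iota 0 k).

Lemma runP k w : reflect (forall i, i < k -> occ w i.*2) (run k w).
Proof.
apply: (iffP allP) => h i; first by move=> ik; apply: h; rewrite mem_iota.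
by rewrite mem_iota => /andP[_]; apply: h.
Qed.

Lemma runS k w : run k.+1 w = occ w 0 && run k (drop 2 w).
Proof.
rewrite /run /= (iotaDl 1 0) all_map; congr (_ && _).
by apply: eq_all => i; rewrite /= occ_drop doubleS.
Qed.

(** Summand [k] describes an initial run of exactly [k] occurrences, at 0, 2, ..., 2k-2; the
    remaining chain starts three letters after the last of them, at 2k+1, and may be a single
    letter. The bound on [size w] excludes one-letter words, for which the sum is empty at
    [l = 0]. *)
Lemma chainb_runs l w : 1 < size w ->
  chainb l.+1 w = \sum_(1 <= k < l.+1) (run k w && chainb (l - k).+1 (drop k.*2.+1 w)) :> nat.
Proof.
elim: l w => [|l IH] w sw.
  by rewrite big_geq // chainb1; case: eqP sw => // ->.
rewrite big_ltn // big_add1 runS chainbSS subSS subn0 andbT.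
case o: (occ w 0); rewrite ?andTb ?andFb; last first.
  by rewrite big1 // => k _; rewrite runS o.
have sw4 := occ_size o.
have -> : (chainb l.+1 (drop 2 w) || chainb l.+1 (drop 3 w)) = chainb l.+1 (drop 2 w) + chainb l.+1 (drop 3 w) :> nat.
  by case h : (chainb l.+1 (drop 2 w)); rewrite ?(chainb_excl h).
rewrite addnC (IH (drop 2 w)) ?size_drop; last lia.
congr (_ + _); apply: eq_bigr => k _.
by rewrite runS o drop_drop subSS doubleS addn2.
Qed.

(** An occurrence starts with its least letter, and the next link starts at one of its later
    letters. *)
Lemma chainb_head_min q v x : chainb q.+1 v -> x \in v -> nth 0 v 0 <= x.
Proof.
elim: q v => [|q IH] v.
  by case: v => [|y [|]] //= _; rewrite inE => /eqP->.
rewrite chainbSS => /andP[o h]; have sv := occ_size o.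
case/and4P: o => _ o1 o2 o3.
have o4 := ltn_trans (ltn_trans o1 o2) o3.
case/orP: h => /IH h; rewrite nth_drop addn0 in h.
  rewrite -{1}(cat_take_drop 2 v) mem_cat => /orP[|/h]; last exact/leq_trans/ltnW.
  case: v sv o1 o2 {o3 o4 h} => [|a [|b v]] //= _ o1 o2.
  by rewrite take0 !inE => /orP[]/eqP->; lia.
rewrite -{1}(cat_take_drop 3 v) mem_cat => /orP[|/h]; last exact/leq_trans/ltnW.
case: v sv o1 o2 {o3 o4 h} => [|a [|b [|e v]]] //= _ o1 o2.
by rewrite take0 !inE => /or3P[]/eqP->; lia.
Qed.

(** Position 2k+1 ends the last occurrence of the run. An occurrence ends with its largest letter,
    and these last letters increase along shift-2 links. *)
Lemma run_max k w i : 0 < k -> run k w -> i <= k.*2 -> nth 0 w i < nth 0 w k.*2.+1.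
Proof.
elim: k w i => // k IH w i _; rewrite runS => /andP[/and4P[_ o1 o2 o3] r] ik.
case: k IH r ik => [|k] IH r ik.
  have -> : 1.*2.+1 = 3 by [].
  by case: i ik => [|[|[|]]] //= _; lia.
have IH' j : j <= k.+1.*2 -> nth 0 w j.+2 < nth 0 w k.+2.*2.+1.
  by move=> jk; have := IH _ j isT r jk; rewrite !nth_drop !addSn !add0n.
case: i ik => [|[|i]] ik; last by apply: IH'.
  by have := IH' 0 isT; lia.
by have := IH' 1 isT; lia.
Qed.

Lemma perm_cat_lt_iota u v a n : perm_eq (u ++ v) (iota a n) ->
  (forall x y, x \in u -> y \in v -> x < y) ->
  perm_eq u (iota a (size u)) /\ perm_eq v (iota (a + size u) (size v)).
Proof.
move=> p lt.
have sz : n = size u + size v by rewrite -size_cat (perm_size p) size_iota.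
have e : sort leq u ++ sort leq v = iota a n.
  apply: (sorted_eq leq_trans anti_leq); last first.
  - by apply: perm_trans p; rewrite perm_cat // perm_sort.
  - exact: iota_sorted.
  rewrite sorted_pairwise; last exact: leq_trans.
  rewrite pairwise_cat -!sorted_pairwise; try exact: leq_trans.
  rewrite !sort_sorted ?andbT; try exact: leq_total.
  by apply/allrelP => x y; rewrite !mem_sort => xu yv; apply/ltnW/lt.
move: e; rewrite sz iotaD => /eqP; rewrite eqseq_cat ?size_sort ?size_iota //.
by case/andP => /eqP<- /eqP<-; rewrite ![perm_eq _ (sort _ _)]perm_sym !perm_sort.
Qed.

(** By [run_max] and [chainb_head_min] the first 2k+1 letters are smaller than all the others, so
    the permutation splits into [u] on 1, ..., 2k+1 and a shifted chain. The run reaches one letter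
    into that chain, its minimum 2k+2, whence [rcons u k.*2.+2]. *)
Lemma count_run_chainb n k q : 0 < k -> k.*2.+1 < n ->
  count (fun w => run k w && chainb q.+1 (drop k.*2.+1 w)) (perms n) =
  count (fun u => run k (rcons u k.*2.+2)) (perms k.*2.+1) *
  count (chainb q.+1) (perms (n - k.*2.+1)).
Proof.
move=> k0 kn.
set K := k.*2.+1.
rewrite -!size_filter -(size_allpairs (fun u v => u ++ map (addn K) v)).
apply/perm_size/uniq_perm.
- exact/filter_uniq/permutations_uniq.
- apply: allpairs_uniq; rewrite ?filter_uniq ?permutations_uniq // => -[u v] [u' v'].
  move=> /allpairsP[[a b] [/= ha hb [-> ->]]] /allpairsP[[a' b'] [/= ha' hb' [-> ->]]].
  move: ha ha'; rewrite !mem_filter => /andP[_ /size_perms sa] /andP[_ /size_perms sa'].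
  move/eqP; rewrite eqseq_cat ?sa ?sa' // => /andP[/eqP-> /eqP/inj_map->] //.
  exact: addnI.
have monoK (v : word) : {in v &, {mono addn K : x y / x < y}} by move=> x y _ _; rewrite ltn_add2l.
have runK u v : size u = K -> 0 < size v -> run k (u ++ v) = run k (rcons u (nth 0 v 0)).
  case: v => // x v su _; apply: eq_in_all => i; rewrite mem_iota => ik /=.
  have sr : size (rcons u x) = K.+1 by rewrite size_rcons su.
  rewrite -cat_rcons -{2}(take_size_cat v sr) occ_take.
  by have -> : i.*2 + 4 <= K.+1 by rewrite /K; lia.
move=> w; rewrite mem_filter; apply/idP/allpairsP.
  move=> /andP[/andP[rw lw] pw]; have sw := size_perms pw.
  set u := take K w; set v := drop K w.
  have su : size u = K by rewrite size_take_min; lia.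
  have sv : size v = n - K by rewrite size_drop; lia.
  have lt x y : x \in u -> y \in v -> x < y.
    move=> /(nthP 0)[i iu <-] yv; apply: leq_trans (chainb_head_min lw yv).
    rewrite su in iu.
    by rewrite nth_drop addn0 nth_take //; apply: run_max.
  have [pu pv] : perm_eq u (iota 1 K) /\ perm_eq v (iota (1 + K) (n - K)).
    by rewrite -{1}su -sv -su; apply: (perm_cat_lt_iota (n := n)) => //; rewrite cat_take_drop -mem_permutations.
  exists (u, map (subn^~ K) v) => /=.
  have ev : v = map (addn K) (map (subn^~ K) v).
    rewrite -map_comp map_id_in // => x; rewrite (perm_mem pv) mem_iota /= => h.
    by lia.
  have v0 : nth 0 v 0 = K.+1.
    have hv : nth 0 v 0 \in v by rewrite mem_nth // sv; lia.
    have h1 : K.+1 \in v by rewrite (perm_mem pv) mem_iota; lia.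
    have := chainb_head_min lw h1; move: hv; rewrite (perm_mem pv) mem_iota -/v; lia.
  split; last by rewrite -ev cat_take_drop.
    by rewrite mem_filter mem_permutations pu andbT -v0 -runK ?cat_take_drop // sv subn_gt0.
  rewrite mem_filter mem_permutations -(chainb_invariant _ (monoK _)) -ev lw /=.
  apply: (perm_trans (perm_map _ pv)).
  by rewrite addnC iotaDl -map_comp map_id_in // => x _ /=; rewrite addKn.
case=> -[u v] /= []; rewrite !mem_filter => /andP[ru pu] /andP[lv pv] ->.
have su := size_perms pu; have sv := size_perms pv.
have v0 : nth 0 v 0 = 1.
  have hv : nth 0 v 0 \in v by rewrite mem_nth // sv; lia.
  have h1 : 1 \in v by move: pv; rewrite mem_permutations => /perm_mem->; rewrite mem_iota; lia.
  have := chainb_head_min lv h1; move: hv pv; rewrite mem_permutations => hv /perm_mem pv.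
  by move: hv; rewrite pv mem_iota; lia.
rewrite drop_size_cat // (chainb_invariant _ (monoK _)) lv andbT; apply/andP; split.
  rewrite runK ?size_map ?sv //; last lia.
  by rewrite (nth_map 0) ?sv ?v0 ?addn1 //; lia.
move: pu pv; rewrite !mem_permutations => pu pv.
have -> : iota 1 n = iota 1 K ++ map (addn K) (iota 1 (n - K)).
  by rewrite -iotaDl addnC -iotaD subnKC //; lia.
by rewrite perm_cat // perm_map.
Qed.

(** * Two-row tableaux and Catalan numbers *)

Definition colstrict (b : nat) (s t : word) : bool :=
  all (fun i => nth 0 s i < nth 0 t i) (iota 0 b).
Arguments colstrict : simpl never.

Lemma colstrictP b s t :
  reflect (forall i, i < b -> nth 0 s i < nth 0 t i) (colstrict b s t).
Proof.
apply: (iffP allP) => h i; first by move=> ib; apply: h; rewrite mem_iota.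
by rewrite mem_iota => /andP[_]; apply: h.
Qed.

(* Standard Young tableaux with rows [p.1], [p.2] of lengths [n - b], [b] and
   entries 2, ..., n + 1. *)
Definition tableau (n b : nat) (p : word * word) : bool :=
  [&& size p.2 == b, b.*2 <= n, perm_eq (p.1 ++ p.2) (iota 2 n),
      pairwise ltn p.1, pairwise ltn p.2
    & colstrict b p.1 p.2].

(** The largest entry [n.+1] ends the first or the second row; the guards keep the second row no
    longer than the first. *)
Fixpoint tableaux (n b : nat) : seq (word * word) :=
  if n is n'.+1 then
    (if b.*2 <= n' then [seq (rcons p.1 n.+1, p.2) | p <- tableaux n' b] else [::]) ++
    (if b is b'.+1 then
       if b.*2 <= n then [seq (p.1, rcons p.2 n.+1) | p <- tableaux n' b'] else [::]
     else [::])
  else if b == 0 then [:: ([::], [::])] else [::].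

Lemma tableauxSS n b : tableaux n.+1 b.+1 =
  (if b.+1.*2 <= n then [seq (rcons p.1 n.+2, p.2) | p <- tableaux n b.+1] else [::]) ++
  (if b.+1.*2 <= n.+1 then [seq (p.1, rcons p.2 n.+2) | p <- tableaux n b] else [::]).
Proof. by []. Qed.

Lemma tableau_size n b p : tableau n b p -> size p.1 + b = n /\ size p.2 = b.
Proof.
by case/and3P => /eqP<- _ /andP[/perm_size]; rewrite size_cat size_iota.
Qed.

Lemma tableau_lt n b p x : tableau n b p -> x \in p.1 ++ p.2 -> x < n.+2.
Proof. by case/and4P=> _ _ /perm_mem-> _; rewrite mem_iota; lia. Qed.

Lemma perm_rcons_iota n s : perm_eq (n.+2 :: s) (iota 2 n.+1) = perm_eq s (iota 2 n).
Proof.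
have -> : iota 2 n.+1 = iota 2 n ++ [:: n.+2] by rewrite -[n.+1]addn1 iotaD addn1.
by rewrite perm_sym perm_catC perm_cons perm_sym.
Qed.

Lemma colstrict_rcons b s t x : b <= size s ->
  colstrict b (rcons s x) t = colstrict b s t.
Proof.
move=> bs; apply: eq_in_all => i; rewrite mem_iota => ib.
by rewrite nth_rcons; have -> : i < size s by lia.
Qed.

Lemma tableau_rcons1 n b s t : b.*2 <= n ->
  tableau n.+1 b (rcons s n.+2, t) = tableau n b (s, t).
Proof.
move=> bn; apply/idP/idP => /[dup] T /tableau_size /= [s1 s2]; last first.
  case/and5P: (T) => /= sb _ p ps /andP[pt al]; rewrite /tableau /= pt sb leqW //.
  rewrite colstrict_rcons; last lia.
  rewrite al pairwise_rcons ps /= !andbT cat_rcons -cat1s perm_catCA cat1s perm_rcons_iota p /=.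
  by apply/allP => y ys; apply: (tableau_lt T); rewrite mem_cat ys.
case/and5P: T => /= _ _; rewrite cat_rcons -cat1s perm_catCA cat1s perm_rcons_iota => p.
rewrite size_rcons in s1; rewrite pairwise_rcons => /andP[_ ps] /andP[pt].
rewrite colstrict_rcons; last lia.
by move=> al; rewrite /tableau /= bn p ps pt al s2 eqxx.
Qed.

Lemma tableau_rcons2 n b s t : b.+1.*2 <= n.+1 ->
  tableau n.+1 b.+1 (s, rcons t n.+2) = tableau n b (s, t).
Proof.
move=> bn.
have al : size t = b -> colstrict b.+1 s (rcons t n.+2) = colstrict b s t && (nth 0 s b < n.+2).
  move=> st; rewrite /colstrict -[b.+1]addn1 iotaD all_cat /= andbT add0n; congr (_ && _).
    by apply: eq_in_all => i; rewrite mem_iota nth_rcons st => /andP[_ ->].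
  by rewrite nth_rcons st ltnn eqxx.
apply/idP/idP => /[dup] T /tableau_size /=; rewrite ?size_rcons => -[s1 s2].
  case/and5P: T => /= _ _; rewrite -rcons_cat perm_rcons perm_rcons_iota => p ps.
  rewrite pairwise_rcons al => [/and3P[/andP[_ pt] a _]|]; last lia.
  by rewrite /tableau /= p ps pt a andbT; lia.
case/and5P: (T) => /= _ _ p ps /andP[pt a].
rewrite /tableau /= al // size_rcons s2 eqxx bn -rcons_cat perm_rcons perm_rcons_iota p ps a.
rewrite pairwise_rcons pt andbT /=; apply/andP; split.
  by apply/allP => y yt; apply: (tableau_lt T); rewrite mem_cat yt orbT.
by apply: (tableau_lt T); rewrite mem_cat mem_nth //=; lia.
Qed.

Lemma mem_tableaux n b (p : word * word) : (p \in tableaux n b) = tableau n b p.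
Proof.
elim: n b p => [|n IH] b [s t].
  case: b => [|b] /=; last first.
    by rewrite /tableau /= andbF.
  rewrite inE xpair_eqE; apply/idP/idP => [/andP[/eqP-> /eqP->] // | /tableau_size /= [h1 h2]].
  by rewrite -!size_eq0 h2 -(addn0 (size s)) h1.
rewrite mem_cat; apply/orP/idP => [[] | T].
- case: leqP => // bn /mapP[[s' t'] h [-> ->]] /=.
  by rewrite tableau_rcons1 // -IH.
- case: b => // b; case: leqP => // bn /mapP[[s' t'] h [-> ->]] /=.
  by rewrite tableau_rcons2 // -IH.
have [s1 s2] := tableau_size T; rewrite /= in s1 s2.
have bn : b.*2 <= n.+1 by case/and3P: T.
have : n.+2 \in s ++ t.
  by case/and4P: T => _ _ /perm_mem-> _; rewrite mem_iota; lia.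
have last_max u y : pairwise ltn (rcons u y) -> n.+2 \in rcons u y -> y < n.+3 -> y = n.+2.
  rewrite pairwise_rcons mem_rcons inE => /andP[/allP h _] /orP[/eqP-> // | /h /=]; lia.
have [ps pt] : pairwise ltn s /\ pairwise ltn t by case/and5P: T => _ _ _ -> /andP[->].
rewrite mem_cat => /orP[ns | nt].
  left; case/lastP: s => [|s y] in T ns ps s1 *; first by [].
  have ey : y = n.+2.
    by apply: last_max ps ns _; apply: (tableau_lt T); rewrite mem_cat mem_rcons mem_head.
  subst y; case: leqP => bn'; last first.
    (* The rows are equally long here, so below the final [n.+2] of the first row there would be a
       larger entry. *)
    exfalso; case: b => [|b] in T bn bn' s1 s2 *; first by [].
    case/and5P: (T) => _ _ _ _ /andP[_ /colstrictP/(_ b (ltnSn b))] /=.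
    rewrite nth_rcons; rewrite size_rcons in s1.
    have -> : (b < size s) = false by lia.
    have -> : (b == size s) by lia.
    have : nth 0 t b < n.+3.
      by apply: (tableau_lt T); rewrite mem_cat mem_nth ?orbT //= s2.
    lia.
  by apply/mapP; exists (s, t) => //; rewrite IH -tableau_rcons1.
right; case/lastP: t => [|t y] in T nt pt s2 *; first by [].
have ey : y = n.+2.
  by apply: last_max pt nt _; apply: (tableau_lt T); rewrite mem_cat mem_rcons mem_head orbT.
subst y; rewrite size_rcons in s2; subst b.
rewrite bn; apply/mapP; exists (s, t) => //.
by rewrite IH -tableau_rcons2.
Qed.

Lemma uniq_tableaux n b : uniq (tableaux n b).
Proof.
elim: n b => [|n IH] b /=; first by case: eqP.
rewrite cat_uniq; apply/and3P; split.
- case: leqP => // bn; rewrite map_inj_uniq // => -[s t] [s' t'] /= [].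
  by move=> /rcons_inj[->] ->.
- case: b => // b; case: (leqP _ n.+1) => // bn; apply/hasPn => _ /mapP[[s t] h ->] /=.
  case: leqP => // bn'; apply/mapP => -[[s' t'] h' [es _]].
  rewrite mem_tableaux in h; have := @tableau_lt _ _ _ n.+2 h.
  by rewrite mem_cat es /= mem_rcons mem_head ltnn => /(_ isT).
- case: b => // b; case: leqP => // bn; rewrite map_inj_uniq // => -[s t] [s' t'] /= [->].
  by move=> /rcons_inj[->].
Qed.

Lemma tableaux_nil n b : n < b.*2 -> tableaux n b = [::].
Proof.
move=> nb; case e : (tableaux n b) => [//|p s].
have : p \in tableaux n b by rewrite e mem_head.
by rewrite mem_tableaux => /and3P[]; lia.
Qed.

(** These are the ballot numbers, obtained from Pascal's rule. The bound admits the boundary case 2b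
    = n+1, where there are no tableaux and the two binomials agree by symmetry; the induction uses
    it. *)
Lemma size_tableaux n b : b.*2 <= n.+1 ->
  size (tableaux n b) + (if b is b'.+1 then 'C(n, b') else 0) = 'C(n, b).
Proof.
elim: n b => [|n IH] [|b] bn //.
  by have := IH 0 isT; rewrite /= cats0 size_map !bin0.
have [bn2|bn2] := leqP b.+1.*2 n.+1; last first.
  rewrite tableaux_nil // add0n -bin_sub; last lia.
  by congr 'C(_, _); lia.
have -> : size (tableaux n.+1 b.+1) = size (tableaux n b.+1) + size (tableaux n b).
  rewrite tableauxSS bn2 size_cat !size_map; case: (leqP b.+1.*2 n) => h; rewrite ?size_map //.
  by rewrite (tableaux_nil h).
have := IH b.+1 bn2; have := IH b; rewrite binS.
by case: b bn bn2 => [|b] bn bn2; rewrite ?binS ?bin0; lia.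
Qed.

Lemma catalan_tableaux k : k.+1 * size (tableaux k.*2 k) = 'C(k.*2, k).
Proof.
have := @size_tableaux k.*2 k (leqnSn _).
case: k => [|k]; first by [].
have := mul_bin_left k.+1.*2 k.
have -> : k.+1.*2 - k = k.+2 by lia.
nia.
Qed.

(** * Runs as interleaved rows of a tableau *)

Fixpoint interleave (t s : word) : word :=
  match t, s with
  | x :: t', y :: s' => x :: y :: interleave t' s'
  | _, _ => [::]
  end.

Lemma interleave_surj k x : size x = k.*2 ->
  exists t s, [/\ size t = k, size s = k & x = interleave t s].
Proof.
elim: k x => [|k IH] [|a [|b x]] //=; first by exists [::], [::].
case=> /IH[t [s [<- es ->]]]; exists (a :: t), (b :: s).
by rewrite /= es.
Qed.

Lemma size_interleave t s : size t = size s -> size (interleave t s) = (size t).*2.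
Proof. by elim: t s => [|x t IH] [|y s] //= [/IH->]. Qed.

Lemma perm_interleave t s : size t = size s -> perm_eq (interleave t s) (s ++ t).
Proof.
elim: t s => [|x t IH] [|y s] //= [/IH p].
by rewrite perm_sym -cat_cons -[x :: t]cat1s perm_catCA /= !perm_cons perm_sym.
Qed.

Lemma interleave_inj t s t' s' : size t = size s -> size t' = size s' ->
  interleave t s = interleave t' s' -> t = t' /\ s = s'.
Proof.
elim: t s t' s' => [|x t IH] [|y s] [|x' t'] [|y' s'] //= [e1] [e2] [-> -> /IH[]] //.
by move=> -> ->.
Qed.

Lemma nth_even_interleave a t s z i : size t = size s -> i <= size s ->
  nth 0 (rcons (a :: interleave t s) z) i.*2 = nth 0 (a :: s) i.
Proof. by elim: t s a i => [|x t IH] [|y s] a [|i] //= [e] /(IH s y i e) <-. Qed.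

Lemma nth_odd_interleave a t s z i : size t = size s -> i <= size s ->
  nth 0 (rcons (a :: interleave t s) z) i.*2.+1 = nth 0 (rcons t z) i.
Proof. by elim: t s a i => [|x t IH] [|y s] a [|i] //= [e] /(IH s y i e) <-. Qed.

(* In a run the letters at odd positions form the second row of a two-row
   tableau and those at positive even positions the first one. *)
Lemma run_interleave k a t s z : size t = k -> size s = k ->
  run k (rcons (a :: interleave t s) z) =
  [&& pairwise ltn (a :: s), pairwise ltn (rcons t z) & colstrict k s t].
Proof.
move=> st ss; rewrite -!sorted_pairwise; try exact: ltn_trans.
have e : size t = size s by rewrite st ss.
set w := rcons _ z; have sw : size w = k.+1.*2.
  by rewrite size_rcons /= size_interleave // st.
have ev i : i <= k -> nth 0 w i.*2 = nth 0 (a :: s) i.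
  by move=> ik; apply: nth_even_interleave; rewrite ?ss.
have od i : i <= k -> nth 0 w i.*2.+1 = nth 0 (rcons t z) i.
  by move=> ik; apply: nth_odd_interleave; rewrite ?ss.
have tz i : i < k -> nth 0 (rcons t z) i = nth 0 t i by move=> ik; rewrite nth_rcons st ik.
have occE i : i < k -> occ w i.*2 =
    [&& nth 0 (a :: s) i < nth 0 s i, nth 0 s i < nth 0 t i & nth 0 t i < nth 0 (rcons t z) i.+1].
  move=> ik; rewrite /occ -doubleS !od ?ev ?(tz i) //; try lia.
  by have -> : i.*2 + 4 <= size w by lia.
apply/runP/and3P => [h | [/(pathP 0) h1 /(sortedP 0) h2 /colstrictP h3] i ik].
  have {}h i ik := etrans (esym (occE i ik)) (h i ik).
  split.
  - by apply/(pathP 0) => i; rewrite ss => /h/and3P[].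
  - by apply/(sortedP 0) => i; rewrite size_rcons st ltnS => ik; rewrite tz //; case/and3P: (h i ik).
  - by apply/colstrictP => i /h/and3P[].
rewrite occE //; apply/and3P; split; [by apply: h1; rewrite ss | exact: h3 |].
by rewrite -tz //; apply: h2; rewrite size_rcons st.
Qed.

(** The first letter is forced to be 1 and the closing letter 2k+2 exceeds all others, so the
    remaining conditions in [run_interleave] are those of a tableau. *)
Lemma count_run k :
  count (fun u => run k (rcons u k.*2.+2)) (perms k.*2.+1) = size (tableaux k.*2 k).
Proof.
rewrite -size_filter -(size_map (fun p => 1 :: interleave p.2 p.1)).
have tsz s t : tableau k.*2 k (s, t) -> size t = k /\ size s = k.
  by move/tableau_size => /= []; lia.
apply/perm_size/uniq_perm.
- exact/filter_uniq/permutations_uniq.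
- rewrite map_inj_in_uniq ?uniq_tableaux // => -[s t] [s' t'].
  rewrite !mem_tableaux => /tsz[e1 e2] /tsz[e1' e2'] /= [] /interleave_inj[]; rewrite ?e1 ?e1' //.
  by move=> -> ->.
move=> u; rewrite mem_filter mem_permutations; apply/andP/mapP => [[ru pu] | [[s t]]].
  case: u => [|a x] in ru pu *; first by move/perm_size: pu.
  have /interleave_surj[t [s [st ss ex]]] : size x = k.*2.
    by move/perm_size: pu; rewrite size_iota => -[].
  move: ru pu; rewrite {x}ex run_interleave // pairwise_rcons pairwise_cons.
  case/and3P => /andP[/allP as_ ps] /andP[_ pt] /colstrictP col pu.
  have e : size t = size s by rewrite st ss.
  (* [a] is smaller than every entry of [s], and each entry of [t] exceeds the entry of [s] above
     it, so [a] is the least letter. *)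
  have a1 : a = 1.
    have h1 : 1 \in a :: interleave t s by rewrite (perm_mem pu) mem_iota.
    have ha : a \in iota 1 k.*2.+1 by rewrite -(perm_mem pu) mem_head.
    move: h1; rewrite inE (perm_mem (perm_interleave e)) mem_cat.
    case/or3P => [/eqP // | /as_ /= | /(nthP 0)[i it ei]]; first by rewrite mem_iota in ha; lia.
    have := col i; rewrite -st => /(_ it); rewrite ei.
    have /as_ /= : nth 0 s i \in s by rewrite mem_nth // -e.
    by lia.
  subst a; exists (s, t) => //; rewrite mem_tableaux /tableau /= st eqxx leqnn ps pt.
  move: pu; rewrite perm_cons (permPl (perm_interleave e)) => -> /=.
  exact/colstrictP.
rewrite mem_tableaux => /[dup] T /tsz[st ss] -> /=.
have e : size t = size s by rewrite st ss.
case/and5P: (T) => /= _ _ p ps /andP[pt col].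
rewrite perm_cons (permPl (perm_interleave e)) p; split=> //.
rewrite run_interleave //= pairwise_rcons ps pt col !andbT; apply/andP; split.
  apply/allP => y ys; have : y \in s ++ t by rewrite mem_cat ys.
  by rewrite (perm_mem p) mem_iota => /andP[].
by apply/allP => y yt; apply: (tableau_lt T); rewrite mem_cat yt orbT.
Qed.

(** * Signed counts of chains over all cuts of a word *)

Local Open Scope ring_scope.

(** For a uniform random permutation the events on the two blocks are independent, and order
    invariance lets each be read on a standard permutation. *)
Lemma sum_perms_blocks n m (p r : pred word) : (m <= n)%N -> order_invariant p -> order_invariant r ->
  \sum_(w <- perms n) (p (take m w))%:R * (r (drop m w))%:R / n`!%:R =
  ((count p (perms m))%:R / m`!%:R) * ((count r (perms (n - m)))%:R / (n - m)`!%:R) :> rat.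
Proof.
move=> mn ip ir; have cnt (s : pred word) t : \sum_(u <- t) (s u)%:R = (count s t)%:R :> rat.
  by rewrite -sum1_count natr_sum [RHS]big_mkcond; apply: eq_bigr => u _; case: (s u).
have fne k : (k`!%:R != 0 :> rat) by rewrite pnatr_eq0 -lt0n fact_gt0.
have sb := sum_blocks (fun w => (p w)%:R : rat) (fun w => (r w)%:R) mn.
rewrite [RHS](eq_big_seq (fun=> (count p (perms m))%:R * (count r (perms (n - m)))%:R)) in sb; last first.
  move=> w; rewrite mem_permutations => pw; rewrite /= !cnt.
  have szw : size w = n by rewrite (perm_size pw) size_iota.
  have uw : uniq w by rewrite (perm_uniq pw) iota_uniq.
  rewrite (count_permutations_st ip (take_uniq m uw)) (count_permutations_st ir (drop_uniq m uw)).
  by rewrite size_take_min size_drop szw (minn_idPl mn).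
rewrite big_const_seq count_predT iter_addr_0 size_permutations ?iota_uniq // size_iota in sb.
rewrite -mulr_suml mulf_div; apply/eqP; rewrite eqr_div ?mulf_neq0 // -natrM mulrC sb.
by rewrite [eqbRHS]mulr_natr.
Qed.

(** A [q]-chain has at least [q] letters, so for [N] larger than [size w] the truncation loses
    nothing. *)
Definition eps (N : nat) (w : word) : rat := \sum_(0 <= q < N) (-1) ^+ q * (chainb q w)%:R.

(** Removing the first link lowers [q] by one and flips the sign; [chainb_excl] turns the two
    possible shifts into a sum. *)
Lemma eps_rec N w : eps N.+2 w =
  (nilp w)%:R - (size w == 1%N)%:R - (occ w 0)%:R * (eps N.+1 (drop 2 w) + eps N.+1 (drop 3 w)).
Proof.
have e1 v : occ w 0 -> (size v + 3 >= size w)%N ->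
    eps N.+1 v = - \sum_(0 <= q < N) (-1) ^+ q * (chainb q.+1 v)%:R.
  move=> /occ_size sw sv; rewrite /eps big_nat_recl //.
  have -> : chainb 0 v = false by rewrite /chainb /nilp; lia.
  by rewrite mulr0 add0r -sumrN; apply: eq_bigr => q _; rewrite exprS mulN1r mulNr.
rewrite {1}/eps !big_nat_recl // expr0 mul1r expr1 mulN1r addrA; congr (_ + _).
case o : (occ w 0); last first.
  rewrite mul0r oppr0 big1 // => q _.
  have -> : chainb q.+2 w = false by apply/negP => /chainb_occ0; rewrite o.
  by rewrite mulr0.
rewrite mul1r !e1 ?size_drop //; try lia.
rewrite -opprD opprK -big_split; apply: eq_bigr => q _.
rewrite chainbSS o !exprS !mulN1r opprK -[RHS]mulrDr -natrD andTb; congr (_ * _%:R).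
by case h : (chainb q.+1 (drop 2 w)); rewrite ?(chainb_excl h) //; case: (chainb _ _).
Qed.

Lemma eps0 N : eps N.+1 [::] = 1.
Proof.
rewrite /eps big_nat_recl // expr0 mul1r big1 ?addr0 // => q _.
have -> : chainb q.+1 [::] = false by apply/negP => /chainb_size.
by rewrite mulr0.
Qed.

Lemma eps1 N x : eps N.+2 [:: x] = -1.
Proof. by rewrite eps_rec /= mul0r subr0 sub0r. Qed.

(* If [w] starts with an occurrence, the induction hypothesis for [drop 2 w] and
   [drop 3 w] leaves the difference of the indicators for [drop 2 w] and
   [drop 1 w], which agree since no occurrence starts at 1. *)
Lemma sum_eps_avoids N w : (0 < size w < N)%N ->
  \sum_(m < (size w).+1) eps N (take m w) * (avoids P1324 (drop m w))%:R = 0.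
Proof.
elim: N w => [|[|N] IH] w hw; [lia | lia |].
have [x [v ew]] : exists x v, w = x :: v by case: w hw => // x v; exists x, v.
have IHd d : (0 < d)%N -> (d < size w)%N ->
    \sum_(d <= m < (size w).+1)
      eps N.+1 (drop d (take m w)) * (avoids P1324 (drop m w))%:R = 0.
  move=> d0 dw; rewrite -[RHS](IH (drop d w)) size_drop; last lia.
  rewrite -{1}(add0n d) big_addn big_mkord subSn //; last lia.
  by apply: eq_bigr => m _; rewrite drop_drop take_drop.
rewrite -(big_mkord xpredT (fun m => eps N.+2 (take m w) * (avoids P1324 (drop m w))%:R)).
rewrite big_ltn // [\sum_(1 <= _ < _) _]big_ltn; last lia.
have take1 : take 1 w = [:: x] by rewrite ew /= take0.
rewrite take0 eps0 mul1r drop0 take1 eps1 mulN1r avoids_drop1.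
have small m : (1 < m <= size w)%N -> eps N.+2 (take m w) =
    if occ w 0 && (4 <= m)%N
    then - (eps N.+1 (drop 2 (take m w)) + eps N.+1 (drop 3 (take m w))) else 0.
  move=> hm; have st : size (take m w) = m by rewrite size_take_min; lia.
  rewrite eps_rec occ_take add0n andbC /nilp st.
  have -> : (m == 0)%N = false by lia.
  have -> : (m == 1)%N = false by lia.
  by rewrite subrr sub0r; case: (_ && _); rewrite ?mul1r // mul0r oppr0.
(* Without an occurrence at 0 only the cuts 0 and 1 contribute, and they cancel. *)
case o : (occ w 0) => /=; last first.
  rewrite addrA subrr add0r big_nat big1 // => m hm.
  by rewrite small ?o ?mul0r //; lia.
have sw := occ_size o.
rewrite (@big_ltn _ _ _ 2) ?(@big_ltn _ _ _ 3); [|lia..].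
rewrite (small 2) ?(small 3); [|lia..].
rewrite !andbF !mul0r !add0r.
have w2 : (2 < size w)%N by lia.
have := IHd 2%N isT w2; rewrite (@big_ltn _ _ _ 2) ?(@big_ltn _ _ _ 3); [|lia..].
have := IHd 3%N isT sw; rewrite (@big_ltn _ _ _ 3); last lia.
have take0' d : drop d (take d w) = [::] by rewrite drop_oversize // size_take_min; lia.
have [y ey] : exists y, drop 2 (take 3 w) = [:: y].
  have : size (drop 2 (take 3 w)) = 1%N by rewrite size_drop size_take_min; lia.
  by case: (drop _ _) => // y [|] //; exists y.
have [N' eN] : exists N', N = N'.+1 by exists N.-1; lia.
rewrite !take0' ey eps0 !mul1r {2}eN eps1 mulN1r.
have -> : avoids P1324 (drop 1 w) = avoids P1324 (drop 2 w).
  by rewrite avoids_drop1 drop_drop occ_drop (occN_next o).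
set a2 := (avoids _ (drop 2 w))%:R; set a3 := (avoids _ (drop 3 w))%:R.
set S3 := \sum_(4 <= m < _) _; set S2 := \sum_(4 <= m < _) _ => h3 h2.
set S := \sum_(4 <= m < _) _.
(* [eps_rec] applied to each cut from 4 on. Now [h2] gives [S2 = a3 - a2] and [h3] gives
   [S3 = - a3], so [S = a2] cancels the cut at 1. *)
have -> : S = - (S2 + S3).
  rewrite -big_split -sumrN; apply: eq_big_nat => m /andP[m4 hm].
  by rewrite small ?o ?m4 ?mulNr ?mulrDl //; apply/andP; split; [apply: leq_trans m4 | ].
lra.
Qed.

(** * The denominator and the product formula *)

Lemma num_chains0 n : num_chains P1324 0 n = (n == 0%N).
Proof.
rewrite num_chainsE; case: n => [|n] //.
by rewrite (eq_in_count (a2 := pred0)) ?count_pred0 // => -[|x w] // /size_perms.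
Qed.

Lemma num_chains1 n : num_chains P1324 1 n = (n == 1%N).
Proof.
rewrite num_chainsE; case: eqP => [-> // | n1].
rewrite (eq_in_count (a2 := pred0)) ?count_pred0 // => w /size_perms sw; rewrite chainb1 sw.
exact/eqP.
Qed.

Lemma num_chains_gt q n : (n < q)%N -> num_chains P1324 q n = 0%N.
Proof. by case: q => // q nq; apply: (@c_eq0 n q). Qed.

(** With [q = l + 1] the sign of the [l]-th term becomes [(-1) ^+ q], and 1 and -t are the terms for
    [q = 0] and [q = 1]. A free bound [N] gives all coefficients in the product the same range of
    [q]. *)
Lemma denom1324E N n : (n < N)%N ->
  denom1324 n = \sum_(0 <= q < N) (-1) ^+ q * ((num_chains P1324 q n)%:R / n`!%:R).
Proof.
move=> nN; rewrite (big_cat_nat (leq0n n.+1) nN) /= [X in _ + X]big_nat.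
rewrite [X in _ + X]big1 ?addr0; last first.
  by move=> q /andP[nq _]; rewrite num_chains_gt // mul0r mulr0.
case: n nN => [|[|n]] nN; rewrite /denom1324 /=.
- by rewrite big_nat1 num_chains0 !subr0 divr1.
- by rewrite big_ltn // big_nat1 num_chains0 num_chains1 /= mul0r mulr0 ?subr0 ?divr1 ?expr1 ?mulr1 ?add0r ?sub0r.
rewrite subr0 sub0r [RHS]big_nat_recl // num_chains0 /= mul0r mulr0 add0r.
rewrite [RHS]big_nat_recl // num_chains1 /= mul0r mulr0 add0r big_add1 -sumrN.
by apply: eq_bigr => l _; rewrite [(-1) ^+ l.+2]exprS mulN1r mulNr mulrA.
Qed.

Lemma egf_avoidingE n : egf_avoiding P1324 n = (num_avoiding P1324 n)%:R / n`!%:R.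
Proof. by case: n => // /=; rewrite divr1. Qed.

Lemma fps_mul_denom1324 n : fps_mul denom1324 (egf_avoiding P1324) n = fps1 n.
Proof.
case: n => [|n]; first by
  rewrite /fps_mul big_ord1 (@denom1324E 1) // big_nat1 num_chains0 egf_avoidingE !divr1.
rewrite /fps_mul /fps1 /=.
(* [sum_eps_avoids] makes every inner sum vanish; exchanging the sums instead gives the product
   coefficient by [sum_perms_blocks], for each cut and each [q]. *)
transitivity (\sum_(w <- perms n.+1) (\sum_(m < n.+2) eps n.+2 (take m w) *
    (avoids P1324 (drop m w))%:R) / (n.+1)`!%:R); last first.
  rewrite big_seq big1 // => w /size_perms sw.
  by have := @sum_eps_avoids n.+2 w; rewrite sw ltnSn => ->; rewrite ?mul0r.
under [RHS]eq_bigr do rewrite mulr_suml.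
rewrite exchange_big; apply: eq_bigr => m _.
rewrite (@denom1324E n.+2) // egf_avoidingE mulr_suml.
under [RHS]eq_bigr do rewrite /eps !mulr_suml.
rewrite exchange_big; apply: eq_bigr => q _.
have mn : (m <= n.+1)%N by rewrite -ltnS.
rewrite num_chainsE -mulrA -sum_perms_blocks //; [|exact: chainb_invariant|exact: avoids_invariant].
by rewrite mulr_sumr; apply: eq_bigr => w _; rewrite !mulrA.
Qed.

(** * The recurrence *)

Lemma c_runs (n l : nat) : (1 < n)%N ->
  c n l = (\sum_(1 <= k < l.+1 | k.*2.+1 < n)
    size (tableaux k.*2 k) * num_chains P1324 (l - k).+1 (n - k.*2.+1))%N.
Proof.
move=> n1.
have cnt (b : pred word) t : (\sum_(w <- t) b w)%N = count b t.
  by rewrite -sum1_count [RHS]big_mkcond; apply: eq_bigr => w _; case: (b w).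
rewrite /c num_chainsE -cnt.
rewrite (eq_big_seq (fun w : word =>
  (\sum_(1 <= k < l.+1) (run k w && chainb (l - k).+1 (drop k.*2.+1 w)))%N)); last first.
  by move=> w /size_perms sw; rewrite -chainb_runs ?sw.
rewrite exchange_big [RHS]big_mkcond; apply: eq_big_nat => k /andP[k0 kl].
rewrite (cnt (fun w => run k w && chainb (l - k).+1 (drop k.*2.+1 w))).
case: ltnP => kn; first by rewrite count_run_chainb // count_run num_chainsE.
(* With [n <= 2k+1] no letter is left for the remaining chain, which cannot be empty. *)
rewrite (eq_in_count (a2 := pred0)) ?count_pred0 // => w /size_perms sw.
by rewrite drop_oversize ?sw //; apply/negP => /andP[_ /chainb_size].
Qed.

Lemma c_rec (n l : nat) : (4 <= n)%N ->
  (c n l)%:R = \sum_(1 <= k < n | (2 * k + 2 <= n)%N)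
    (1 / k.+1%:R) * 'C(2 * k, k)%:R * (c (n - 2 * k - 1) (l%:Z - k%:Z))%:R :> rat.
Proof.
move=> n4; rewrite c_runs; last lia.
(* The ranges [k <= l] and [k < n] are widened to a common one. For [k > l] the index [l - k] is
   negative, where [c] is 0. *)
rewrite natr_sum (@big_nat_widen _ _ _ _ _ (l + n).+1); last lia.
rewrite [RHS](@big_nat_widen _ _ _ _ _ (l + n).+1); last lia.
rewrite big_mkcond [RHS]big_mkcond; apply: eq_big_nat => k /andP[k0 _].
have -> : (2 * k + 2 <= n)%N && (k < n)%N = (k.*2.+1 < n)%N by lia.
case: (ltnP k.*2.+1 n) => //= kn.
case: (ltnP k l.+1) => kl; last first.
  have -> : l%:Z - k%:Z = Negz (k - l).-1 by lia.
  by rewrite /= mulr0.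
have -> : l%:Z - k%:Z = Posz (l - k) by lia.
have -> : (n - 2 * k - 1 = n - k.*2.+1)%N by lia.
rewrite /c natrM mul2n -catalan_tableaux natrM mulrA mul1r mulVf ?mul1r //.
by rewrite pnatr_eq0.
Qed.

Theorem theorem4p12 :
  [/\ forall l : int, c 1 l = (0 == l),
      forall l : int, c 2 l = 0%N /\ c 3 l = 0%N,
      forall n l : nat, (4 <= n)%N ->
        (c n l)%:R = \sum_(1 <= k < n | (2 * k + 2 <= n)%N)
          (1 / k.+1%:R) * 'C(2 * k, k)%:R
            * (c (n - 2 * k - 1) (l%:Z - k%:Z))%:R :> rat
    & forall n : nat,
        fps_mul denom1324 (egf_avoiding P1324) n = fps1 n].
Proof.
split.
- case=> [[|l]|l] //; first exact: num_chains1.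
  exact: (@c_eq0 1 l.+1).
- have c0 n l : (1 < n < 4)%N -> c n l = 0%N.
    move=> hn; case: l => // l; rewrite c_runs; last by case/andP: hn.
    (* No [k >= 1] satisfies 2k+1 < n when n < 4. *)
    by rewrite big_nat_cond big1 // => k; lia.
  by move=> l; rewrite !c0.
- exact: c_rec.
- exact: fps_mul_denom1324.
Qed.
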